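(* Let $q$ be a power of a prime, let $c \in \mathbb{F}_q$, and let $n \geq 2$ and $w$ be integers with $1 \leq w \leq n$. If $w = n$, assume that $c \neq 0$. If $(n,w,c) = (2,1,0)$, further assume that $q$ is odd. Then there exists a monic irreducible polynomial $P(x)$ of degree $n$ over $\mathbb{F}_q$ with $[x^{n-w}]P(x) = c$.
   Context: For a polynomial $h(x) \in \mathbb{F}_q[x]$ and an integer $m$, $[x^m]h(x)$ denotes the coefficient of $x^m$ in $h(x)$. *)

(* Defs.v *)
From HB Require Import structures.
From mathcomp Require Export all_boot all_order all_algebra.

Set Implicit Arguments.
Unset Strict Implicit.
Unset Printing Implicit Defensive.

(* Main.v *)
Require Import Defs.
From mathcomp Require Import all_boot all_order all_algebra.
From mathcomp Require Import all_fingroup all_solvable all_field.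
From mathcomp Require Import zify ring.

(** Write [q = #|F|] and let [sigma] be the polynomial whose value at an element
    [x] of the field with [q ^ n] elements is the [w]-th elementary symmetric
    function of its conjugates [x ^+ (q ^ i)], [i < n].  If the theorem fails,
    then [1 - (sigma - c') ^+ q.-1], with [c' = (-1) ^+ w * c], vanishes at every
    [x] of degree [n].  The nonzero [x] of smaller degree satisfy [x ^+ (q ^ d) = x]
    for some [0 < d <= n / 2], so there are at most [\sum_(1 <= d <= n / 2) (q ^ d - 1)]
    of them, and a nonzero polynomial, taken modulo ['X^(q ^ n - 1) - 1], that
    vanishes elsewhere cannot have too long a cyclic run of zero coefficients.
    But [sigma] has degree at most [\sum_(n - w <= i < n) q ^ i] and valuation
    [\sum_(i < w) q ^ i], which produces such a run.
    The case [c = 0], [n = 2 w] is the only tight one: there one first multiplies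
    by ['X^(q ^ w - 1) - 1], which kills the elements of degree dividing [w], and
    has to check by hand that the product is nonzero. *)

Set Implicit Arguments.
Unset Strict Implicit.
Unset Printing Implicit Defensive.

Import GRing.Theory.
Local Open Scope ring_scope.

(** * Elementary symmetric functions and Vieta's formula *)

Fixpoint elsym (R : nzRingType) (t : nat -> R) (n w : nat) : R :=
  match w, n with
  | 0, _ => 1
  | w'.+1, 0 => 0
  | w'.+1, n'.+1 => elsym t n' w + t n' * elsym t n' w'
  end.

Section ElementarySymmetric.

Variable R : comNzRingType.
Implicit Type t : nat -> R.

Lemma elsym0 t n : elsym t n 0 = 1.
Proof. by case: n. Qed.

Lemma elsym_gt t n w : (n < w)%N -> elsym t n w = 0.
Proof.
elim: n w => [|n IHn] [|w] //= lt_nw.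
by rewrite !IHn ?mulr0 ?addr0 // ltnW.
Qed.

(** Vieta's formula, by expanding along the last factor; the form [k + w = n] keeps truncated
    subtraction out of the induction. *)
Lemma coef_prod_XsubC_elsym t n k w : (k + w = n)%N ->
  (\prod_(i < n) ('X - (t i)%:P))`_k = (-1) ^+ w * elsym t n w.
Proof.
elim: n k w => [|n IHn] k w.
  by case: k w => [|k] [|w] // _; rewrite big_ord0 coef1 mulr1.
rewrite big_ord_recr /= mulrBr coefB coefMX coefMC.
case: k w => [|k] [|w] //= Dn.
- rewrite sub0r (IHn 0%N w) ?(@elsym_gt t n w.+1); [|lia..].
  by rewrite exprS; ring.
- rewrite (IHn k 0%N) ?elsym0 ?expr0 ?mulr1; last lia.
  have -> : k.+1 = size (\prod_(i < n) ('X - (t i)%:P)).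
    by rewrite size_prod_XsubC /index_enum -enumT size_enum_ord; lia.
  by rewrite nth_default ?mul0r ?subr0.
rewrite (IHn k w.+1) ?(IHn k.+1 w); [|lia..].
by rewrite exprS; ring.
Qed.

Lemma elsym_exp_pchar t q n w : [pchar R].-nat q ->
  elsym t n w ^+ q = elsym (fun i => t i ^+ q) n w.
Proof.
move=> pq; elim: n w => [|n IHn] [|w] /=; rewrite ?expr1n ?expr0n //.
  by case: q pq.
by rewrite exprDn_pchar // exprMn !IHn.
Qed.

End ElementarySymmetric.

(** * Degree, valuation and low coefficients of [sigma] *)

Definition gsum (q w : nat) : nat := \sum_(i < w) q ^ i.

Lemma gsum0 q : gsum q 0 = 0%N.
Proof. exact: big_ord0. Qed.

Lemma gsumS q w : gsum q w.+1 = (gsum q w + q ^ w)%N.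
Proof. exact: big_ord_recr. Qed.

Lemma gsum_geom q w : (0 < q)%N -> (q.-1 * gsum q w + 1 = q ^ w)%N.
Proof. by move=> q0; rewrite -predn_exp addn1 prednK ?expn_gt0 ?q0. Qed.

Lemma gsum_lt q w : (1 < q)%N -> (gsum q w < q ^ w)%N.
Proof. by move=> q1; rewrite -(@gsum_geom q w) ?(ltnW q1) //; nia. Qed.

Lemma leq_gsum q : {homo gsum q : m n / (m <= n)%N}.
Proof.
apply: homo_leq => [//|x y z|w]; first exact: leq_trans.
by rewrite gsumS leq_addr.
Qed.

(** The sum bounds the number of nonzero elements of degree at most [m]; in terms of [gsum] it can
    be compared with the degree and valuation of [sigma]. *)
Lemma sum_predn_exp q m : (0 < q)%N ->
  (\sum_(i < m) (q ^ i.+1).-1 + m.+1 = gsum q m.+1)%N.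
Proof.
move=> q0; elim: m => [|m IHm]; first by rewrite big_ord0 gsumS gsum0.
rewrite big_ord_recr /= gsumS -IHm.
have: (0 < q ^ m.+1)%N by rewrite expn_gt0 q0.
by case: (q ^ m.+1)%N => // k _ /=; lia.
Qed.

Definition sigma (R : nzRingType) (q n w : nat) : {poly R} :=
  elsym (fun i => 'X^(q ^ i)) n w.

Section Sigma.

Variables (R : comNzRingType) (q : nat).
Hypothesis q_gt1 : (1 < q)%N.
Local Notation sigma := (sigma R q).

Lemma sigmaS n w : sigma n.+1 w.+1 = sigma n w.+1 + 'X^(q ^ n) * sigma n w.
Proof. by []. Qed.

Lemma horner_sigma n w x : (sigma n w).[x] = elsym (fun i => x ^+ (q ^ i)) n w.
Proof.
elim: n w => [|n IHn] [|w]; rewrite ?hornerC //.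
by rewrite sigmaS hornerD hornerM hornerXn !IHn.
Qed.

(** The top monomial is the product of the ['X^(q ^ i)] with [n - w <= i < n]. *)
Lemma size_sigma n w : (w <= n)%N ->
  (size (sigma n w) <= (gsum q n - gsum q (n - w)).+1)%N.
Proof.
elim: n w => [|n IHn] [|w] // le_wn; rewrite ?subn0 ?subnn ?size_poly1 //.
have le1 : (gsum q (n - w) <= gsum q n)%N by rewrite leq_gsum ?leq_subr.
rewrite sigmaS subSS; apply: leq_trans (size_polyD _ _) _.
rewrite geq_max; apply/andP; split.
  have [lt_wn|?] := ltnP w n; last by rewrite /sigma elsym_gt ?size_poly0.
  apply: leq_trans (IHn _ lt_wn) _; rewrite gsumS.
  have -> : (n - w = (n - w.+1).+1)%N by lia.
  rewrite gsumS.
  have : (q ^ (n - w.+1) <= q ^ n)%N by rewrite leq_exp2l // leq_subr.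
  lia.
apply: leq_trans (size_polyMleq _ _) _.
by have := IHn w le_wn; rewrite size_polyXn gsumS; lia.
Qed.

(** No [w] distinct powers [q ^ i] have a sum below that of the first [w]. *)
Lemma sigma_coef_lt n w k : (k < gsum q w)%N -> (sigma n w)`_k = 0.
Proof.
elim: n w k => [|n IHn] [|w] k; rewrite ?gsum0 // ?coef0 // => lt_k.
rewrite sigmaS coefD IHn // add0r coefXnM; case: ltnP => // le_k.
have [lt_nw|le_wn] := ltnP n w; first by rewrite /sigma elsym_gt ?coef0.
rewrite IHn //; move: lt_k; rewrite gsumS.
have : (q ^ w <= q ^ n)%N by rewrite leq_exp2l.
lia.
Qed.

Lemma sigma_coef_gsum n w : (w <= n)%N -> (sigma n w)`_(gsum q w) = 1.
Proof.
elim: n w => [|n IHn] [|w] le_wn; rewrite ?gsum0 ?coef1 //.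
rewrite sigmaS coefD coefXnM; have [lt_wn|le_nw] := ltnP w n.
  rewrite IHn // ifT ?addr0 // (leq_trans (gsum_lt w.+1 q_gt1)) //.
  by rewrite leq_exp2l.
have -> : w = n by lia.
by rewrite gsumS ltnNge leq_addl addnK IHn // {1}/sigma elsym_gt // coef0 add0r.
Qed.

(* The exponent [gsum q w + q ^ w.+1] is the second smallest one. *)
Lemma sigma_coef_second n w : (w.+1 < n)%N ->
  (sigma n w.+1)`_(gsum q w + q ^ w.+1) = 1.
Proof.
elim: n => // n IHn lt_wn; rewrite sigmaS coefD coefXnM.
have lt_q : (q ^ w < q ^ w.+1)%N by rewrite ltn_exp2l.
have lt_g := gsum_lt w q_gt1.
have [lt_wn1|le_nw] := ltnP w.+1 n.
  rewrite IHn // ifT ?addr0 //.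
  have /leq_trans-> // : (gsum q w + q ^ w.+1 < q ^ w.+2)%N.
    rewrite [(q ^ w.+2)%N]expnS (leq_trans _ (leq_mul q_gt1 (leqnn _))) //.
    by rewrite mul2n -addnn ltn_add2r (ltn_trans lt_g).
  by rewrite leq_exp2l.
have -> : n = w.+1 by lia.
(* The degree of [sigma w.+1 w.+1] is below the wanted exponent, so the 1 is the lowest coefficient
   of the other summand, [sigma w.+1 w]. *)
rewrite nth_default ?add0r.
  by rewrite ltnNge leq_addl addnK sigma_coef_gsum.
apply: leq_trans (size_sigma (leqnn _)) _.
by rewrite subnn gsum0 gsumS; lia.
Qed.

End Sigma.

(** * Finite fields and roots of unity *)

Lemma card_finField_pnat (F : finFieldType) : [pchar F].-nat #|F|.
Proof.
have [p p_pr pF] := finPcharP F.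
have /= := fin_ring_pchar_abelem pF; move/abelem_pgroup.
rewrite /pgroup cardsT; apply: sub_in_pnat => r _ /eqP->; exact: pF.
Qed.

Lemma expf_pred (K : idomainType) (x : K) q :
  (0 < q)%N -> x != 0 -> (x ^+ q.-1 == 1) = (x ^+ q == x).
Proof.
move=> q0 x0; rewrite -[in RHS](prednK q0) exprS -[X in _ = (_ == X)]mulr1.
by rewrite (inj_eq (mulfI x0)).
Qed.

(** Stands in for the field with [#|F| ^ n] elements: [rs] plays the role of its nonzero
    elements. *)
Lemma root_unity_splitting (F : finFieldType) n : (0 < n)%N ->
  exists (L : fieldType) (f : {rmorphism F -> L}) (rs : seq L),
    [/\ uniq rs, size rs = (#|F| ^ n).-1
      & {in rs, forall x, x ^+ (#|F| ^ n).-1 = 1}].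
Proof.
move=> n0; have q1 := finNzRing_gt1 F.
have m1 : (1 < #|F| ^ n)%N by rewrite (ltn_exp2l 0).
set N := (#|F| ^ n).-1; have N0 : (0 < N)%N by rewrite -ltnS prednK // ltnW.
have nz : 'X^N - 1 != 0 :> {poly F} by rewrite monic_neq0 ?monicXnsubC.
have [L /= [rs Drs _]] := FinSplittingFieldFor nz.
rewrite [map_poly _ _]rmorphB rmorphXn /= map_polyX rmorph1 in Drs.
exists L, (in_alg L), rs; split.
- rewrite -separable_prod_XsubC -(eqp_separable Drs).
  rewrite cyclotomic.separable_Xn_sub_1 // /N -subn1 natrB ?(ltnW m1) //.
  (* Since [#|F|] is 0 in [L], the exponent [#|F| ^ n - 1] is -1 there, which gives separability. *)
  have q0 : #|F|%:R = 0 :> L.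
    have := @expg_cardG F [set: F]%G 1%R (in_setT _).
    rewrite cardsT FinRing.zmodXgE.
    by move/(congr1 (in_alg L)); rewrite rmorph_nat rmorph0.
  by rewrite natrX q0 expr0n gtn_eqF // sub0r oppr_eq0 oner_eq0.
- apply: succn_inj; rewrite -(size_prod_XsubC _ id) -(eqp_size Drs).
  by rewrite size_XnsubC.
move=> x; rewrite -root_prod_XsubC -(eqp_root Drs) rootE !hornerE.
by rewrite subr_eq0 => /eqP.
Qed.

(** * Conjugates and minimal polynomials over the base field *)

Section Conjugates.

Variables (F : finFieldType) (L : fieldType) (f : {rmorphism F -> L}).
Local Notation q := #|F|.

Lemma card_pnat_ext : [pchar L].-nat q.
Proof.
by rewrite (eq_pnat _ (fmorph_pchar f)) card_finField_pnat.
Qed.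

(** The elements of [F] already account for all the roots of ['X^q - 'X]. *)
Lemma fixed_in_base (y : L) : y ^+ q = y -> exists x, f x = y.
Proof.
move=> Dy; have /(congr1 (map_poly f)) := finField_genPoly F.
rewrite map_prod_XsubC rmorphB rmorphXn /= map_polyX => /(congr1 (horner^~ y)).
rewrite !hornerE Dy subrr horner_prod => /esym/eqP.
rewrite prodf_seq_eq0 => /hasP[x _ /=]; rewrite !hornerE subr_eq0 => /eqP->.
by exists x.
Qed.

Lemma horner_map_expq (g : {poly F}) y :
  (map_poly f g).[y ^+ q] = (map_poly f g).[y] ^+ q.
Proof.
have q0 : (0 < q)%N := ltnW (finNzRing_gt1 F).
elim/poly_ind: g => [|g c IHg].
  by rewrite rmorph0 !horner0 expr0n gtn_eqF.
rewrite rmorphD rmorphM /= map_polyX map_polyC /= !hornerE IHg.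
by rewrite (exprDn_pchar _ _ card_pnat_ext) exprMn -(rmorphXn f) expf_card.
Qed.

Section DegreeN.

Variables (n : nat) (x : L).
Hypotheses (n_gt0 : (0 < n)%N) (xq : x ^+ (q ^ n) = x).
Hypothesis xdeg : forall d, (0 < d <= n./2)%N -> x ^+ (q ^ d) != x.

Lemma expq_period d k : x ^+ (q ^ d) = x -> x ^+ (q ^ (k * d)) = x.
Proof.
by move=> Dd; elim: k => [|k IHk]; rewrite ?expr1 // mulSn expnD exprM Dd.
Qed.

(* The least period divides [n], so it is [n] or at most [n / 2]. *)
Lemma expq_neq d : (0 < d < n)%N -> x ^+ (q ^ d) != x.
Proof.
move=> /andP[d0 dn]; apply/eqP => Dd.
have ex : exists d, (0 < d)%N && (x ^+ (q ^ d) == x).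
  by exists d; rewrite d0 Dd eqxx.
case: (ex_minnP ex) => e /andP[e0 /eqP De] emin.
have led : (e <= d)%N by rewrite emin // d0 Dd eqxx.
have : (n %% e == 0)%N.
  rewrite -leqn0 leqNgt; apply/negP => r0.
  have := emin (n %% e)%N; rewrite r0 /= leqNgt ltn_mod e0 => /(_ _)/negP[] //.
  rewrite -[X in _ == X]xq {2}(divn_eq n e) expnD exprM.
  by rewrite expq_period.
move/eqP => ne0; suff /xdeg : (0 < e <= n./2)%N by rewrite De eqxx.
rewrite e0 /=.
have Dn := divn_eq n e; rewrite ne0 addn0 in Dn.
have : (1 < n %/ e)%N by rewrite ltnNge; apply/negP => le1; nia.
move=> lt1; have : (2 * e <= n)%N by nia.
lia.
Qed.

Lemma conj_uniq : uniq [seq x ^+ (q ^ i) | i <- iota 0 n].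
Proof.
rewrite map_inj_in_uniq ?iota_uniq // => i j; rewrite !mem_iota /= !add0n.
wlog lt_ij : i j / (i < j)%N => [wl|] ltin ltjn Dij.
  by case: (ltngtP i j) => // lt_ij; [|apply/esym]; apply: wl.
have [] := negP (@expq_neq (j - i)%N _); first by lia.
(* Raising both conjugates to the power [q ^ (n - i)] turns the [i]-th into [x] and the [j]-th into
   [x ^+ (q ^ (j - i))]. *)
have -> : (x ^+ (q ^ (j - i)) = (x ^+ (q ^ j)) ^+ (q ^ (n - i))).
  rewrite -exprM -expnD; have -> : (j + (n - i) = n + (j - i))%N by lia.
  by rewrite expnD exprM xq.
by rewrite -Dij -exprM -expnD subnKC ?xq // ltnW.
Qed.

(** The [q]-th power map permutes the factors cyclically, so the coefficients of the product are
    fixed and lie in [F]. A nonconstant divisor over [F] has one conjugate as a root, hence all [n]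
    of them, hence full degree. *)
Lemma conj_poly_irreducible : exists P : {poly F},
  [/\ P \is monic, size P = n.+1, irreducible_poly P
    & map_poly f P = \prod_(i < n) ('X - (x ^+ (q ^ i))%:P)].
Proof.
pose t i := x ^+ (q ^ i); pose PL := \prod_(i < n) ('X - (t i)%:P).
have PLE : PL = \prod_(y <- [seq x ^+ (q ^ i) | i <- iota 0 n]) ('X - y%:P).
  rewrite big_map /PL -(big_mkord xpredT (fun i => 'X - (t i)%:P)).
  by rewrite /index_iota subn0.
have sPL : size PL = n.+1 by rewrite PLE size_prod_XsubC size_map size_iota.
have shift : \prod_(i < n) ('X - (t i ^+ q)%:P) = PL.
  have tS i : t i ^+ q = t i.+1 by rewrite /t expnSr exprM.
  rewrite /PL; case: n n_gt0 xq => // k _ xk.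
  rewrite big_ord_recr big_ord_recl /= tS mulrC; congr (_ * _).
    by rewrite {1}/t xk /t expr1.
  by apply: eq_bigr => i _; rewrite tS.
have coefq k : PL`_k ^+ q = PL`_k.
  have [lt_k|le_k] := ltnP n k.
    rewrite nth_default ?sPL // expr0n gtn_eqF //.
    exact: ltnW (finNzRing_gt1 F).
  have Dk : (k + (n - k) = n)%N by lia.
  rewrite -[in RHS]shift (coef_prod_XsubC_elsym (fun i => t i ^+ q) Dk).
  rewrite (coef_prod_XsubC_elsym t Dk) exprMn.
  rewrite (elsym_exp_pchar _ _ _ card_pnat_ext); congr (_ * _).
  by rewrite exprAC (exprNn_pchar _ card_pnat_ext) expr1n.
have [/= P DP] : exists P : {poly F}, map_poly f P = PL.
  have /fin_all_exists[g Dg] (k : 'I_n.+1) : exists c, f c = PL`_k.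
    exact: fixed_in_base.
  exists (\poly_(k < n.+1) g (inord k)); apply/polyP => k.
  rewrite coef_map coef_poly /=; case: ltnP => [lt_k|le_k].
    by rewrite Dg inordK.
  by rewrite rmorph0 nth_default ?sPL.
exists P; have sP : size P = n.+1 by rewrite -sPL -DP size_map_poly.
split=> //.
  by rewrite -(map_monic f) DP PLE monic_prod_XsubC.
split=> [|g g1 gP]; first by rewrite sP.
have nzg : g != 0.
  by apply: dvdpN0 gP _; rewrite -size_poly_eq0 sP.
rewrite -(dvdp_size_eqp gP) eqn_leq dvdp_leq -?size_poly_eq0 ?sP //=.
have : map_poly f g %| PL by rewrite -DP dvdp_map.
rewrite PLE => /dvdp_prod_XsubC[m Dg].
have [y gy ys] : exists2 y, root (map_poly f g) y
    & y \in [seq x ^+ (q ^ i) | i <- iota 0 n].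
  case Dm : (mask m [seq x ^+ (q ^ i) | i <- iota 0 n]) => [|y s].
    case/eqP: g1; rewrite -(size_map_poly f) (eqp_size Dg) Dm big_nil.
    exact: size_poly1.
  exists y; first by rewrite (eqp_root Dg) Dm root_prod_XsubC mem_head.
  by apply: (@mem_mask _ _ m); rewrite Dm mem_head.
case/mapP: ys => i; rewrite mem_iota add0n /= => lt_in Dy.
have rootS z k : root (map_poly f g) z -> root (map_poly f g) (z ^+ (q ^ k)).
  move=> gz; elim: k => [|k IHk] //; rewrite expnSr exprM rootE horner_map_expq.
  by rewrite (eqP IHk) expr0n gtn_eqF // ltnW // finNzRing_gt1.
have gx : root (map_poly f g) x.
  by have := rootS y (n - i)%N gy; rewrite Dy -exprM -expnD subnKC ?xq // ltnW.
rewrite -(size_map_poly f) -[n in (n < _)%N](size_iota 0 n).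
rewrite -(size_map (fun i => x ^+ (q ^ i))).
apply: max_poly_roots conj_uniq; first by rewrite map_poly_eq0.
by apply/allP => z /mapP[k _ ->]; apply: rootS.
Qed.

End DegreeN.
End Conjugates.

(** * Counting roots of polynomials built from [sigma] *)

Lemma dvdXnP (K : fieldType) (p : {poly K}) a :
  reflect (forall k, (k < a)%N -> p`_k = 0) ('X^a %| p).
Proof.
apply: (iffP idP) => [/dvdpP[r ->] k lt_k|p0].
  by rewrite coefMXn lt_k.
rewrite -(poly_take_drop a p) (_ : take_poly a p = 0) ?add0r ?dvdp_mulIr //.
by apply/polyP => k; rewrite coef_take_poly coef0; case: ltnP => // /p0.
Qed.

Section Counting.

Variables (L : fieldType) (q : nat).
Hypothesis q_gt1 : (1 < q)%N.

Lemma size_small_degree m (s : seq L) : uniq s -> 0 \notin s ->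
  {in s, forall x, exists2 d, (0 < d <= m)%N & x ^+ (q ^ d) = x} ->
  (size s <= \sum_(i < m) (q ^ i.+1).-1)%N.
Proof.
elim: m s => [|m IHm] s us s0 sP.
  by case: s us s0 sP => // x s _ _ /(_ x (mem_head _ _))[d]; lia.
rewrite big_ord_recr /= -(count_predC (fun x => x ^+ (q ^ m.+1) == x) s) addnC.
have q0 : (0 < q ^ m.+1)%N by rewrite expn_gt0 (ltnW q_gt1).
have Q1 : (1 < q ^ m.+1)%N by rewrite (ltn_exp2l 0).
have N0 : (0 < (q ^ m.+1).-1)%N by rewrite -ltnS prednK.
rewrite -!size_filter leq_add //.
  apply: IHm; rewrite ?filter_uniq //.
    by rewrite mem_filter (negPf s0) andbF.
  move=> x; rewrite mem_filter /= => /andP[xm /sP[d]].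
  have [->|ne] := eqVneq d m.+1; first by move=> _ /eqP; rewrite (negPf xm).
  by exists d => //; lia.
have nz : 'X^((q ^ m.+1).-1) - 1 != 0 :> {poly L}.
  by rewrite monic_neq0 ?monicXnsubC.
have /= := @max_poly_roots _ _ [seq x <- s | x ^+ (q ^ m.+1) == x] nz.
rewrite size_XnsubC // ltnS; apply; last exact: filter_uniq.
apply/allP => x; rewrite mem_filter => /andP[xm xs].
rewrite rootE !hornerE subr_eq0 expf_pred //.
by apply: contraNneq s0 => <-.
Qed.

(** For [m = n./2] and [x ^+ (q ^ n) = x] this means degree [n]; [m] is left free because the case
    [n = 2 w] uses [m = w - 1]. *)
Definition large_degree m (x : L) :=
  forall d, (0 < d <= m)%N -> x ^+ (q ^ d) != x.

(** A nonzero [G] has fewer than [size G] roots, and the non-roots in [rs] have small degree, so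
    together they cannot fill [rs]. *)
Lemma vanishing_eq0 (G : {poly L}) m (rs : seq L) : uniq rs -> 0 \notin rs ->
    {in rs, forall x, large_degree m x -> root G x} ->
    (size G + \sum_(i < m) (q ^ i.+1).-1 <= size rs)%N ->
  G = 0.
Proof.
move=> us s0 Gs le; apply/eqP; apply: contraLR le => nzG; rewrite -ltnNge.
rewrite -(count_predC (root G) rs) -!size_filter.
rewrite -addSn leq_add //.
  by apply: max_poly_roots; rewrite ?filter_all ?filter_uniq.
apply: size_small_degree; rewrite ?filter_uniq //.
  by rewrite mem_filter (negPf s0) andbF.
move=> x; rewrite mem_filter /= => /andP[nGx xs].
have /hasP[d] : has (fun d => x ^+ (q ^ d) == x) (iota 1 m).
  apply: contraR nGx => /hasPn ndx; apply: Gs => // d dm.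
  by apply: ndx; rewrite mem_iota; lia.
by rewrite mem_iota => dm /eqP; exists d => //; lia.
Qed.

Variables (n w : nat) (rs : seq L).
Hypotheses (pq : [pchar L].-nat q) (n_gt1 : (1 < n)%N) (w_gt0 : (0 < w)%N).
Hypotheses (w_le : (w <= n)%N) (rs_uniq : uniq rs).
Hypotheses (rs_size : size rs = (q ^ n).-1).
Hypotheses (rsX : {in rs, forall x, x ^+ (q ^ n).-1 = 1}).
Local Notation sigma := (sigma L q n w).
Local Notation b := (gsum q w).
Local Notation a := (q ^ w).-1.
Local Notation N := (q ^ n).-1.

Let q_gt0 : (0 < q)%N := ltnW q_gt1.

Lemma pow_gt0 k : (0 < q ^ k)%N. Proof. by rewrite expn_gt0 q_gt0. Qed.

Lemma pow_gt1 k : (0 < k)%N -> (1 < q ^ k)%N.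
Proof. by move=> k0; rewrite (ltn_exp2l 0). Qed.

Lemma N_gt0 : (0 < N)%N.
Proof. by rewrite -ltnS prednK ?pow_gt0 ?pow_gt1 // ltnW. Qed.

Lemma rs0 : 0 \notin rs.
Proof.
apply/negP => /rsX/eqP; rewrite expr0n gtn_eqF ?N_gt0 //=.
by rewrite eq_sym oner_eq0.
Qed.

Lemma gsum_gt0 : (0 < b)%N.
Proof. by case: (w) w_gt0 => // k _; rewrite gsumS ltn_addl ?pow_gt0. Qed.

Lemma sum_predn_lt m : (\sum_(i < m) (q ^ i.+1).-1 + m < gsum q m.+1)%N.
Proof. by rewrite -sum_predn_exp // addnS. Qed.

Definition sigma_low : {poly L} := drop_poly b sigma.
Local Notation s := sigma_low.

Lemma sigma_lowE : sigma = s * 'X^b.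
Proof.
rewrite -[LHS](poly_take_drop b) (_ : take_poly b _ = 0) ?add0r //.
apply/polyP => k; rewrite coef_take_poly coef0.
by case: ltnP => // /sigma_coef_lt->.
Qed.

Lemma sigma_low0 : s`_0 = 1.
Proof. by rewrite coef_drop_poly sigma_coef_gsum. Qed.

Lemma mulnb : (b * q.-1 = a)%N.
Proof. by rewrite mulnC predn_exp. Qed.

Lemma sigma_expE : sigma ^+ q.-1 = s ^+ q.-1 * 'X^a.
Proof. by rewrite sigma_lowE exprMn -exprM mulnb. Qed.

Lemma size_sigma_shift (c : L) :
  (size (sigma - c%:P)%R <= (gsum q n - gsum q (n - w)).+1)%N.
Proof.
apply: leq_trans (size_polyD _ _) _.
rewrite geq_max size_sigma // size_polyN (leq_trans (size_polyC_leq1 _)) //.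
Qed.

Lemma muln_gsumB k : (k <= n)%N ->
  ((gsum q n - gsum q k) * q.-1 = q ^ n - q ^ k)%N.
Proof.
move=> le_kn; rewrite mulnBl mulnC -predn_exp mulnC -predn_exp.
by have := pow_gt0 k; lia.
Qed.

(** Where [sigma - c] takes a value in the field with [q] elements, this polynomial is 1 if that
    value is 0, and 0 otherwise. *)
Lemma size_indicator (c : L) :
  (size (1 - (sigma - c%:P) ^+ q.-1)%R <= (q ^ n - q ^ (n - w)).+1)%N.
Proof.
apply: leq_trans (size_polyD _ _) _.
rewrite geq_max size_poly1 size_polyN /=.
apply: leq_trans (size_poly_exp_leq _ _) _; rewrite ltnS.
rewrite -muln_gsumB ?leq_subr // leq_mul2r; apply/orP; right.
by have := size_sigma_shift c; case: (size _).
Qed.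

Lemma size_sigma_low_exp :
  (size (s ^+ q.-1)%R <= (q ^ n - q ^ (n - w) - a).+1)%N.
Proof.
apply: leq_trans (size_poly_exp_leq _ _) _; rewrite ltnS.
have sb : ((size s).-1 <= gsum q n - gsum q (n - w) - b)%N.
  rewrite size_drop_poly -subn1 subnAC leq_sub2r // leq_subLR add1n.
  exact: size_sigma.
apply: leq_trans (leq_mul sb (leqnn _)) _.
by rewrite mulnBl muln_gsumB ?leq_subr // mulnb.
Qed.

Lemma leq_pow_a : (a <= N)%N.
Proof. by rewrite -!subn1 leq_sub2r // leq_exp2l. Qed.

(** For nonzero [c] the constant term of [h] vanishes, so the gap below exponent [b] and the gap
    above the degree join into one cyclic run of zeros. *)
Lemma sigma_exp_neq1 (c : L) : c ^+ q.-1 = 1 ->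
  ~ {in rs, forall x, large_degree n./2 x -> (sigma.[x] - c) ^+ q.-1 = 1}.
Proof.
move=> c1 sig1; pose h := 1 - (sigma - c%:P) ^+ q.-1.
have b0 := gsum_gt0.
have h0 : h != 0.
  apply/eqP => /eqP; rewrite subr_eq0 => /eqP.
  move/(congr1 (fun p : {poly L} => (size p).-1)).
  rewrite size_exp size_poly1 /= => /esym/eqP; rewrite muln_eq0.
  case/orP; last by lia.
  move=> s1; have : (sigma - c%:P)`_b = 0.
    by apply: nth_default; move: s1 b0; case: (size _) => [|[]] //; lia.
  rewrite coefB sigma_coef_gsum // coefC gtn_eqF // subr0 => /eqP.
  by rewrite oner_eq0.
have Dh : 'X^b %| h.
  (* Writing 1 as a power of [- c] makes [h] a difference of [q.-1]-th powers, divisible by the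
     difference of the bases, which is [sigma] up to sign. *)
  have -> : h = (- c%:P) ^+ q.-1 - (sigma - c%:P) ^+ q.-1.
    congr (_ - _); rewrite -[- _]mulN1r exprMn -rmorphXn c1 mulr1.
    have /eqP : (-1) ^+ q.-1 == 1 :> {poly L}; last by move->.
    rewrite expf_pred ?oppr_eq0 ?oner_eq0 // (exprNn_pchar _ _) ?expr1n //.
    by rewrite (eq_pnat _ (@pchar_poly _)).
  rewrite subrXX dvdp_mulr // opprD opprK addrCA addNr addr0.
  by rewrite dvdpNr sigma_lowE dvdp_mulIr.
have := Dh; rewrite dvdp_eq => /eqP; set g := _ %/ _ => hE.
case/negP: h0; rewrite hE mulf_eq0; apply/orP; left; apply/eqP.
have gE : g = drop_poly b h by rewrite hE drop_polyMXn_id.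
apply: (vanishing_eq0 rs_uniq rs0 (m := n./2)) => [x xs xd|].
  have : h.[x] == 0 by rewrite !hornerE /= sig1 // subrr.
  rewrite hE hornerM hornerXn mulf_eq0 expf_eq0 => /orP[//|/andP[_ /eqP x0]].
  by have := rs0; rewrite -x0 xs.
rewrite gE size_drop_poly rs_size.
have le_h : (size h - b <= (q ^ n - q ^ (n - w)).+1 - b)%N.
  by rewrite leq_sub2r ?size_indicator.
apply: leq_trans (leq_add le_h (leqnn _)) _.
have := sum_predn_lt n./2; set E := (\sum_(i < _) _)%N => ltE.
(* The count needs [E + 2 <= q ^ (n - w) + b], and [E + 2] is at most this [gsum]. The term [b]
   suffices when [n./2 < w], the term [q ^ (n - w)] when [w < n./2], and equality uses both. *)
have leE : (gsum q n./2.+1 <= q ^ (n - w) + b)%N.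
  have [lt_w|] := ltnP n./2 w.
    by rewrite (leq_trans (leq_gsum _ lt_w)) ?leq_addl.
  rewrite leq_eqVlt => /orP[/eqP Dw|lt_w].
    by rewrite gsumS Dw addnC leq_add2r leq_exp2l //; lia.
  rewrite ltnW // (leq_trans (gsum_lt _ q_gt1)) //.
  rewrite (leq_trans _ (leq_addr _ _)) //.
  by rewrite leq_exp2l //; lia.
(* Settles the count should the subtraction of [b] truncate to 0. *)
have g1Q : (gsum q n./2.+1 < q ^ n)%N.
  by rewrite (leq_trans (gsum_lt _ q_gt1)) // leq_exp2l //; lia.
have leP : (q ^ (n - w) <= q ^ n)%N by rewrite leq_exp2l ?leq_subr.
have n2 : (0 < n./2)%N by lia.
move: ltE leE leP n2 g1Q.
move: (q ^ (n - w))%N (q ^ n)%N (gsum q n./2.+1) => B Q g1.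
lia.
Qed.

Lemma two_eq0_pow : 2%:R = 0 :> L -> ~~ odd q.
Proof.
move=> two0; have pchar2 : 2 \in [pchar L] by rewrite inE /= two0 eqxx.
have /pnatP := pq; move=> /(_ q_gt0)/(_ _ (pdiv_prime q_gt1) (pdiv_dvd q)).
rewrite (pcharf_eq pchar2) => /eqP D2.
by have := pdiv_dvd q; rewrite D2 dvdn2.
Qed.

(* If [s ^+ q.-1 = 1 %[mod 'X^a]], then [s = s ^+ (q ^ w) %[mod 'X^a]], and the
   latter is [1] since [s - 1] has no constant term. *)
Lemma sigma_low_mod : 'X^a %| s ^+ q.-1 - 1 -> 'X^a %| s - 1.
Proof.
move=> S1; have sq : 'X^a %| s ^+ q - s.
  have -> : s ^+ q - s = (s ^+ q.-1 - 1) * s.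
    by rewrite mulrBl -exprSr prednK ?mul1r.
  by rewrite dvdp_mulr.
have sqk k : 'X^a %| s ^+ (q ^ k) - s.
  elim: k => [|k IHk]; first by rewrite subrr dvdp0.
  rewrite expnSr exprM -(subrK (s ^+ q) (_ ^+ q)) -addrA dvdp_add //.
  by rewrite subrXX dvdp_mulr.
have s1w : 'X^a %| s ^+ (q ^ w) - 1.
  have /dvdXnP/dvdpP[t Dt] : forall k, (k < 1)%N -> (s - 1)`_k = 0.
    by case=> // _; rewrite coefB sigma_low0 coef1 subrr.
  rewrite -{1}(subrK 1 s) exprDn_pchar; last first.
    by rewrite pnatX (eq_pnat _ (@pchar_poly _)) pq.
  rewrite expr1n addrK Dt exprMn -exprM mul1n dvdp_mull // dvdp_exp2l //.
  exact: leq_pred.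
have -> : s - 1 = (s ^+ (q ^ w) - 1) - (s ^+ (q ^ w) - s) by ring.
by rewrite dvdp_sub.
Qed.

(** The case [c = 0]. The run of zeros comes from the valuation [a] of [sigma ^+ q.-1] when
    [n < 2 w] and from its degree when [n > 2 w]; for [n = 2 w] an extra factor is needed. *)
Lemma sigma_exp_neq1_zero : (w < n)%N -> (n = 2%N -> w = 1%N -> odd q) ->
  ~ {in rs, forall x, large_degree n./2 x -> sigma.[x] ^+ q.-1 = 1}.
Proof.
move=> w_lt qodd sig1; set S := s ^+ q.-1.
have S0 : S`_0 = 1.
  by rewrite -horner_coef0 horner_exp horner_coef0 sigma_low0 expr1n.
have nz_rs x : x \in rs -> x != 0 by move=> xs; apply: contraNneq rs0 => <-.
have sigE x : sigma.[x] ^+ q.-1 = S.[x] * x ^+ a.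
  by rewrite -horner_exp sigma_expE hornerM hornerXn.
have lt_aN : (a < N)%N.
  by rewrite -ltnS !prednK ?pow_gt0 // ltn_exp2l.
have xNa x : x \in rs -> x ^+ (N - a) * x ^+ a = 1.
  by move=> xs; rewrite -exprD subnK ?rsX // leq_pow_a.
have sS : (size S <= (N - a).+1)%N.
  apply: leq_trans size_sigma_low_exp _; have := pow_gt0 (n - w); lia.
have [n_lt|n_gt|Dn] := ltngtP n w.*2.
- have lt_w : (n./2 < w)%N by lia.
  (* On [rs], [G * 'X^a] takes the values of [1 - sigma ^+ q.-1]. *)
  pose G := 'X^(N - a) - S.
  have : G`_0 != 0.
    by rewrite coefB coefXn S0 ltn_eqF ?subn_gt0 // sub0r oppr_eq0 oner_eq0.
  case/eqP; rewrite (_ : G = 0) ?coef0 //.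
  apply: (vanishing_eq0 rs_uniq rs0 (m := n./2)) => [x xs xd|].
    rewrite rootE -(mulIr_eq0 _ (mulIf (expf_neq0 a (nz_rs x xs)))).
    by rewrite hornerD hornerN hornerXn mulrBl xNa // -sigE sig1 // subrr.
  rewrite rs_size.
  have sG : (size G <= (N - a).+1)%N.
    apply: leq_trans (size_polyD _ _) _.
    by rewrite geq_max size_polyXn leqnn size_polyN sS.
  apply: leq_trans (leq_add sG (leqnn _)) _.
  have := sum_predn_lt n./2; have := leq_gsum q lt_w; have := gsum_lt w q_gt1.
  set E := (\sum_(i < _) _)%N; move: lt_aN.
  by move: (q ^ w)%N (q ^ n)%N (gsum q _.+1) (gsum q w) E => A Q g1 g2 E; lia.
(* Here [n./2.+1 <= n - w], so the gap of about [q ^ (n - w)] above the degree is long enough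
   alone. *)
- pose h := 1 - (sigma - 0%:P) ^+ q.-1.
  have b0 := gsum_gt0.
  have : h`_0 != 0.
    rewrite -horner_coef0 !hornerE /= subr0 horner_coef0 sigma_coef_lt //.
    by rewrite expr0n gtn_eqF ?subr0 ?oner_eq0 //; lia.
  case/eqP; rewrite (_ : h = 0) ?coef0 //.
  apply: (vanishing_eq0 rs_uniq rs0 (m := n./2)) => [x xs xd|].
    by rewrite rootE !hornerE /= subr0 sig1 // subrr.
  rewrite rs_size; apply: leq_trans (leq_add (size_indicator 0) (leqnn _)) _.
  have := sum_predn_lt n./2; have := gsum_lt n./2.+1 q_gt1.
  have : (q ^ n./2.+1 <= q ^ (n - w))%N by rewrite leq_exp2l //; lia.
  have : (q ^ (n - w) <= q ^ n)%N by rewrite leq_exp2l ?leq_subr.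
  have n2 : (0 < n./2)%N by lia.
  set E := (\sum_(i < _) _)%N; move: n2.
  move: (q ^ (n - w))%N (q ^ n)%N (gsum q _.+1) (q ^ _.+1)%N E => A Q g1 g2 E.
  lia.
(* On [rs], [G * 'X^a] takes the values of
   [('X^a - 1) * (1 - sigma ^+ q.-1)]. *)
pose G := 1 - 'X^(N - a) + S - S * 'X^a.
have DN : (N = a * (a + 2))%N.
  rewrite Dn -addnn expnD; have := pow_gt0 w.
  by case: (q ^ w)%N => // k _; lia.
have a0 : (0 < a)%N by have := pow_gt1 w_gt0; lia.
have G0 : G = 0.
  (* The factor ['X^a - 1] vanishes wherever [x ^+ (q ^ w) = x], so only degrees below [w] remain
     exceptional. *)
  apply: (vanishing_eq0 rs_uniq rs0 (m := w.-1)) => [x xs xd|].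
    rewrite rootE -(mulIr_eq0 _ (mulIf (expf_neq0 a (nz_rs x xs)))).
    have -> : G.[x] * x ^+ a = (x ^+ a - 1) * (1 - sigma.[x] ^+ q.-1).
      transitivity (x ^+ a - x ^+ (N - a) * x ^+ a + S.[x] * x ^+ a
                    - S.[x] * x ^+ a * x ^+ a); last first.
        by rewrite xNa // -sigE; ring.
      rewrite !(hornerD, hornerN) hornerM !hornerXn hornerC; ring.
    have [->|xa] := eqVneq (x ^+ a) 1; first by rewrite subrr mul0r.
    rewrite sig1 ?subrr ?mulr0 // => d dm.
    have [->|ne] := eqVneq d w; last by apply: xd; lia.
    by rewrite -expf_pred ?pow_gt0 ?nz_rs.
  rewrite rs_size.
  have sG : (size G <= (N - a).+1)%N.
    apply: leq_trans (size_polyD _ _) _; rewrite geq_max size_polyN.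
    apply/andP; split; last first.
      apply: leq_trans (size_polyMleq _ _) _; rewrite size_polyXn addnS /=.
      have := size_sigma_low_exp; rewrite -/S {2}Dn -addnn addnK.
      move: DN a0 lt_aN; move: (q ^ w)%N (q ^ n)%N (size S) => A Q z; nia.
    apply: leq_trans (size_polyD _ _) _; rewrite geq_max sS andbT.
    apply: leq_trans (size_polyD _ _) _.
    by rewrite geq_max size_poly1 size_polyN size_polyXn /=.
  apply: leq_trans (leq_add sG (leqnn _)) _.
  have := sum_predn_lt w.-1; rewrite prednK //; have := gsum_lt w q_gt1.
  set E := (\sum_(i < _) _)%N; move: lt_aN a0.
  by move: (q ^ w)%N (q ^ n)%N (gsum q w) E => A Q g1 E; lia.
(* Modulo ['X^a], [G] is [1 + S], as [N - a = a * (a + 1)] is at least [a]. So [S] is -1 there, and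
   its constant term 1 forces characteristic 2. *)
have coefS k : (k < a)%N -> S`_k = - (k == 0)%:R.
  move=> lt_k; have := congr1 (fun p : {poly L} => p`_k) G0.
  rewrite coefB coefD coefB coef1 coefXn coefMXn lt_k coef0 subr0.
  rewrite [k == (N - a)%N]ltn_eqF ?subr0; last by nia.
  by move/eqP; rewrite addr_eq0 eq_sym eqr_oppLR => /eqP.
have two0 : 2%:R = 0 :> L.
  by rewrite mulr2n -{1}S0 coefS // eqxx addNr.
have /sigma_low_mod/dvdXnP s1 : 'X^a %| S - 1.
  apply/dvdXnP => k lt_k; rewrite coefB coefS // coef1.
  by rewrite -opprD -mulr2n -[_ *+ 2]mulr_natr two0 mulr0 oppr0.
have [w1|w_gt1] : w = 1%N \/ (1 < w)%N by lia.
  by have := two_eq0_pow two0; rewrite qodd // Dn w1.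
have Dwq : (w = w.-1.+1)%N by lia.
have lt_q : (q ^ w.-1 < q ^ w)%N by rewrite ltn_exp2l //; lia.
have q1' : (1 < q ^ w.-1)%N by rewrite pow_gt1 //; lia.
(* The second monomial of [sigma] gives [s] a coefficient 1 at this index, which is positive and
   below [a]: a contradiction. *)
have := s1 (q ^ w - q ^ w.-1)%N; rewrite coefB coef1 coef_drop_poly.
have -> : (q ^ w - q ^ w.-1 + b = gsum q w.-1 + q ^ w)%N.
  have -> : b = (gsum q w.-1 + q ^ w.-1)%N by rewrite -gsumS -Dwq.
  by move: lt_q; move: (q ^ w)%N (q ^ w.-1)%N => A B; lia.
rewrite gtn_eqF ?subn_gt0 // subr0.
have := @sigma_coef_second L q q_gt1 n w.-1; rewrite -Dwq => -> // one0.
suff /one0/eqP : (q ^ w - q ^ w.-1 < a)%N by rewrite oner_eq0.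
by move: lt_q q1'; move: (q ^ w)%N (q ^ w.-1)%N => A B; lia.
Qed.

End Counting.

(** * Existence of an irreducible polynomial with the prescribed coefficient *)

Theorem theorem1p1 (F : finFieldType) (c : F) (n w : nat)
    (hn : (2 <= n)%N) (hw : (1 <= w <= n)%N)
    (hc : w = n -> c != 0)
    (hq : [/\ n = 2%N, w = 1%N & c = 0] -> odd #|F|) :
  exists P : {poly F},
    [/\ P \is monic, size P = n.+1, irreducible_poly P & P`_(n - w) = c].
Proof.
have /andP[w_gt0 w_le] := hw; have n_gt0 : (0 < n)%N := ltnW hn.
have q_gt1 := finNzRing_gt1 F.
have [L [f [rs [rs_uniq rs_size rsX]]]] := root_unity_splitting F n_gt0.
have pq : [pchar L].-nat #|F| := card_pnat_ext f.
pose c' := (-1) ^+ w * c.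
have sgn0 : (-1) ^+ w != 0 :> F by rewrite signr_eq0.
have conjP x : x \in rs -> large_degree #|F| n./2 x -> exists P : {poly F},
    [/\ P \is monic, size P = n.+1, irreducible_poly P
      & (sigma L #|F| n w).[x] = f ((-1) ^+ w * P`_(n - w))].
  move=> xs xd; have xq : x ^+ (#|F| ^ n) = x.
    by rewrite -[(_ ^ n)%N]prednK ?pow_gt0 // exprS rsX ?mulr1.
  have [P [P1 sP irrP DP]] := conj_poly_irreducible f n_gt0 xq xd.
  exists P; split=> //; rewrite horner_sigma rmorphM rmorphXn rmorphN1 -coef_map /=.
  rewrite DP (coef_prod_XsubC_elsym (fun i => x ^+ (#|F| ^ i)) (subnK w_le)).
  by rewrite mulrA -expr2 sqrr_sign mul1r.
(* A boolean form of [large_degree], so that [rs] can be searched for an element of degree [n] where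
   [sigma] equals [f c']. *)
pose degb (x : L) := all (fun d => x ^+ (#|F| ^ d) != x) (iota 1 n./2).
have degP x : reflect (large_degree #|F| n./2 x) (degb x).
  apply: (iffP allP) => xd d; last by rewrite mem_iota => dm; apply: xd; lia.
  by move=> dm; apply: xd; rewrite mem_iota; lia.
have [/hasP[x xs /andP[/degP xd /eqP Dx]]|/hasPn none] :=
    boolP (has (fun x => degb x && ((sigma L #|F| n w).[x] == f c')) rs).
  have [P [P1 sP irrP]] := conjP x xs xd; rewrite Dx => /fmorph_inj DP.
  by exists P; split=> //; apply/esym/(mulfI sgn0).
(* With no such element, [sigma.[x] - f c'] is always the image of a nonzero element of [F]. *)
have sig1 x : x \in rs -> large_degree #|F| n./2 x ->
    ((sigma L #|F| n w).[x] - f c') ^+ #|F|.-1 = 1.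
  move=> xs xd; have [P [_ _ _ DP]] := conjP x xs xd.
  have := none x xs; rewrite (introT (degP x) xd) /= -subr_eq0 DP -rmorphB => nz.
  by apply/eqP; rewrite expf_pred ?(ltnW q_gt1) // -rmorphXn expf_card.
have [c0|nzc] := eqVneq c 0.
  have w_lt : (w < n)%N.
    by rewrite ltn_neqAle w_le andbT; apply/eqP => /hc; rewrite c0 eqxx.
  case: (sigma_exp_neq1_zero q_gt1 pq hn w_gt0 w_le rs_uniq rs_size rsX w_lt).
    by move=> n2 w1; apply: hq.
  move=> x xs xd.
  by have := sig1 x xs xd; rewrite /c' c0 mulr0 rmorph0 subr0.
have c'1 : f c' ^+ #|F|.-1 = 1.
  apply/eqP; rewrite expf_pred ?(ltnW q_gt1) -?rmorphXn ?expf_card //.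
  by rewrite fmorph_eq0 mulf_neq0.
by case: (sigma_exp_neq1 q_gt1 pq hn w_gt0 w_le rs_uniq rs_size rsX c'1).
Qed.
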